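(* Let $w=(p,q)\in\mathbb R_{>0}^2$, put $m(w)=\min\{p,q\}$, let $z_0\in V$, and let $\gamma_w(r)=(r^p,r^q,z_0)$ for $0<r<r_0$. Then exactly one of the following alternatives holds: (i) $\mathcal H_\mu(w)<2m(w)$, and then $L_{g_\mu}(\gamma_w)<\infty$. (ii) $\mathcal H_\mu(w)>2m(w)$, and then $L_{g_\mu}(\gamma_w)=\infty$. (iii) $\mathcal H_\mu(w)=2m(w)$, and then $$L_{g_\mu}(\gamma_w)<\infty\iff\int^\infty\Lambda_{\mu,w}(s)^{1/2}\,ds<\infty.$$
   Context: Let $k\ge0$, let $V\subset\mathbb R^k$ be open, let $\varepsilon>0$, and let $U=[0,\varepsilon)^2\times V$ with coordinates $(x,y,z)$ (an adapted chart of a manifold with corners near the codimension-two corner stratum $\{x=y=0\}$), with $U^\circ=(0,\varepsilon)^2\times V$. Let $g_{\mathrm E}$ be the Euclidean metric and $g_0$ a smooth Riemannian metric on $U$ with $c_0g_{\mathrm E}\le g_0\le C_0g_{\mathrm E}$ for constants $0<c_0\le C_0<\infty$. Let $\mu$ be a finite nonzero positive Radon measure with compact support $E=\operatorname{supp}\mu\subset\mathbb R_{\ge0}^2$. Let $u:E\times U^\circ\to(0,\infty)$ be jointly measurable with $0<c_u\le u(\alpha;x,y,z)\le C_u<\infty$ for $\mu$-almost every $\alpha\in E$ and every $(x,y,z)\in U^\circ$, and assume that $F_\mu(x,y,z)=\int_E u(\alpha;x,y,z)x^{-\alpha_1}y^{-\alpha_2}\,d\mu(\alpha)$ is continuous and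 positive on $U^\circ$. Put $g_\mu=F_\mu g_0$, and let $L_{g_\mu}$ denote $g_\mu$-length. For $w=(p,q)\in\mathbb R_{>0}^2$ put $\mathcal H_\mu(w)=\max_{\alpha\in E}(p\alpha_1+q\alpha_2)$, $\Delta_w(\alpha)=\mathcal H_\mu(w)-\langle w,\alpha\rangle\ge0$, and $\Lambda_{\mu,w}(s)=\int_E e^{-s\Delta_w(\alpha)}\,d\mu(\alpha)$ for $s\ge0$. The number $r_0\in(0,1)$ is small enough that $r_0^p,r_0^q<\varepsilon$. The notation $\int^\infty$ means the integral over $[s_0,\infty)$ for some (equivalently any) $s_0\ge0$. *)

(* Defs.v *)
From HB Require Import structures.
From mathcomp Require Import all_boot all_order all_algebra.
From mathcomp Require Import all_classical all_reals all_analysis.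
Set Implicit Arguments.
Unset Strict Implicit.
Unset Printing Implicit Defensive.
Import Order.TTheory GRing.Theory Num.Theory.
Import numFieldNormedType.Exports.
Local Open Scope classical_set_scope.
Local Open Scope ring_scope.

Definition exactly_one (A B C : Prop) : Prop :=
  [\/ [/\ A, ~ B & ~ C], [/\ ~ A, B & ~ C] | [/\ ~ A, ~ B & C]].

Section Smoothness.
Context {R : realType} {n : nat}.
Implicit Types (W A : set 'rV[R]_n) (f : 'rV[R]_n -> R).

(* f is of class C^m on W; only meaningful for open W. *)
Fixpoint class_C (m : nat) W f : Prop :=
  (forall p, W p -> {for p, continuous f}) /\
  if m is m'.+1 then
    forall i : 'I_n, let e_i : 'rV[R]_n := delta_mx 0 i in
      (forall p, W p -> derivable f p e_i) /\ class_C m' W ('D_e_i f)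
  else True.

(* Smoothness on an arbitrary subset, in the sense used for manifolds with
   corners: locally near each point of A (boundary points included), f is the
   restriction of a C^oo function defined on an open subset of R^n. *)
Definition smooth_on A f : Prop :=
  forall p, A p -> exists (W : set 'rV[R]_n) (h : 'rV[R]_n -> R),
    [/\ open W, W p, forall m, class_C m W h
      & forall q, W q -> A q -> f q = h q].

End Smoothness.

Section Metrics.
Context {R : realType} {n : nat}.
Implicit Types (A : set 'rV[R]_n) (g h : 'rV[R]_n -> 'M[R]_n).

(* A metric on a subset of R^n is given by its matrix in the standard
   coordinates. *)
Definition inner g (p v w : 'rV[R]_n) : R := (v *m g p *m w^T) 0 0.

Definition euclidean_metric (p : 'rV[R]_n) : 'M[R]_n := 1%:M.

Definition smooth_riemannian_metric_on A g : Prop :=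
  [/\ forall i j, smooth_on A (fun p => g p i j),
      forall p, A p -> (g p)^T = g p
    & forall p v, A p -> v != 0 -> 0 < inner g p v v].

Definition metric_le A g h : Prop :=
  forall p v, A p -> inner g p v v <= inner h p v v.

Definition scale_metric (f : 'rV[R]_n -> R) g (p : 'rV[R]_n) : 'M[R]_n :=
  f p *: g p.

Definition curve_length g (gamma : R -> 'rV[R]_n) (a b : R) : \bar R :=
  \int[lebesgue_measure]_(r in `]a, b[)
    (Num.sqrt (inner g (gamma r) (gamma^`()%classic r) (gamma^`()%classic r)))%:E.

End Metrics.

Section Chart.
Context {R : realType} {k : nat}.
Implicit Types (p : 'rV[R]_(2 + k)) (V : set 'rV[R]_k).

Definition coord_x p : R := p 0 (lshift k 0).
Definition coord_y p : R := p 0 (lshift k 1).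
Definition coord_z p : 'rV[R]_k := rsubmx p.

Definition chart_point (x y : R) (z : 'rV[R]_k) : 'rV[R]_(2 + k) :=
  row_mx (\row_(j < 2) (if j == 0 then x else y)) z.

Definition chart (eps : R) V : set 'rV[R]_(2 + k) :=
  [set p | [/\ 0 <= coord_x p < eps, 0 <= coord_y p < eps & V (coord_z p)]].

Definition chart_interior (eps : R) V : set 'rV[R]_(2 + k) :=
  [set p | [/\ 0 < coord_x p < eps, 0 < coord_y p < eps & V (coord_z p)]].

Definition monomial_curve (w : R * R) (z0 : 'rV[R]_k) (r : R) :
    'rV[R]_(2 + k) :=
  chart_point (r `^ w.1) (r `^ w.2) z0.

End Chart.

Section Exponents.
Context {R : realType}.
Context (mu : {finite_measure set (R * R)%type -> \bar R}).

Definition supp : set (R * R)%type :=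
  [set a | forall A : set (R * R)%type, open A -> A a -> (0 < mu A)%E].

Definition F_mu {k : nat} (u : R * R -> 'rV[R]_(2 + k) -> R)
    (p : 'rV[R]_(2 + k)) : R :=
  \int[mu]_(a in supp)
    (u a p * coord_x p `^ (- a.1) * coord_y p `^ (- a.2)).

Definition pairing (w a : R * R) : R := w.1 * a.1 + w.2 * a.2.

(* When supp is compact and nonempty, this supremum is a maximum. *)
Definition H_mu (w : R * R) : R := sup [set pairing w a | a in supp].

Definition Delta (w a : R * R) : R := H_mu w - pairing w a.

Definition Lambda (w : R * R) (s : R) : R :=
  \int[mu]_(a in supp) expR (- s * Delta w a).

End Exponents.

(* Main.v *)
Require Import Defs.
From HB Require Import structures.
From mathcomp Require Import all_boot all_order all_algebra.
From mathcomp Require Import all_classical all_reals all_analysis.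
From mathcomp Require Import measurable_realfun ring lra.
Import Order.TTheory GRing.Theory Num.Theory.
Import numFieldNormedType.Exports.
Local Open Scope classical_set_scope.
Local Open Scope ring_scope.

(* Along the curve substitute r = e^(-s). With m = min(p, q), the squared Euclidean
   speed is r^(-2) e^(-2ms) up to constants, and the conformal factor F_mu is
   e^(sH) Lambda(s) up to constants because x^(-a1) y^(-a2) = e^(sH) e^(-s Delta(a)).
   So the length is finite iff the integral of e^(-(m - H/2)s) Lambda(s)^(1/2) over a
   half-line is. Lambda is bounded, and for every delta > 0 it is at least
   c e^(-s delta) because H is attained on the support and every neighbourhood of a
   support point has positive measure; the sign of m - H/2 then decides. *)

(* Unlike [ge0_le_integral], no measurability: the integral of a nonnegative function
   is a supremum over simple functions. *)
Lemma ge0_le_integral_nomeas d (T : measurableType d) (R : realType)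
    (mu : {measure set T -> \bar R}) (D : set T) (f g : T -> \bar R) :
  (forall x, D x -> (0 <= f x)%E) -> (forall x, D x -> (f x <= g x)%E) ->
  (\int[mu]_(x in D) f x <= \int[mu]_(x in D) g x)%E.
Proof.
move=> f0 fg; have g0 x : D x -> (0 <= g x)%E.
  by move=> Dx; exact: le_trans (f0 _ Dx) (fg _ Dx).
rewrite !ge0_integralE//; apply: ereal_sup_le => _ /= [h hf <-].
by exists h => // x; apply: le_trans (hf x) _; exact: lee_restrict.
Qed.

(** * Countable base and Borel sets of the plane *)

Section plane.
Context {R : realType}.

(** Boxes with rational endpoints form the base. Countability serves twice: it makes open sets
    measurable for the product sigma-algebra, and it makes the complement of the support null. *)
Lemma countable_base_plane : exists B : nat -> set (R * R),
  (forall n, measurable (B n)) /\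
  forall (A : set (R * R)) x, open A -> A x -> exists2 n, B n x & B n `<=` A.
Proof.
pose box (q : rat * rat * (rat * rat)) : set (R * R) :=
  `]ratr q.1.1, ratr q.1.2[ `*` `]ratr q.2.1, ratr q.2.2[.
exists (fun n => if unpickle n is Some q then box q else set0); split.
  move=> n; case: (unpickle n) => [q|]; last exact: measurable0.
  by apply: measurableX; exact: measurable_itv.
move=> A x oA Ax; have [e /= e0 eA] : nbhs_ball x A by apply/nbhs_ballP; exact: open_nbhs_nbhs.
(* A ball of the product is a product of balls, so one rational interval per coordinate suffices. *)
have rat_itv (t : R) : exists q : rat * rat,
    [set` `]ratr q.1, ratr q.2[] t /\ [set` `]ratr q.1, ratr q.2[] `<=` ball t e.
  have [a] : exists q : rat, (ratr q : R) \in `]t - e, t[ by apply: rat_in_itvoo; lra.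
  have [b] : exists q : rat, (ratr q : R) \in `]t, t + e[ by apply: rat_in_itvoo; lra.
  rewrite !in_itv/= => /andP[tb bte] /andP[tea at_]; exists (a, b) => /=.
  rewrite in_itv/= at_ tb; split => // s /=; rewrite in_itv/= => /andP[as_ sb].
  by rewrite /ball/= ltr_norml; apply/andP; split; lra.
have [q1 [xq1 q1e]] := rat_itv x.1; have [q2 [xq2 q2e]] := rat_itv x.2.
exists (pickle (q1, q2)); rewrite pickleK //.
move=> y [/= y1 y2]; apply: eA; split; [exact: q1e|exact: q2e].
Qed.

Lemma open_measurable_plane (A : set (R * R)) : open A -> measurable A.
Proof.
move=> oA; have [B [mB BA]] := countable_base_plane.
suff -> : A = \bigcup_(n in [set n | B n `<=` A]) B n by exact: bigcup_measurable.
by apply/seteqP; split=> [x /(BA _ _ oA)[n Bnx BnA]|x [n /= + Bnx]]; [exists n|exact].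
Qed.

Lemma compact_measurable_plane (A : set (R * R)) : compact A -> measurable A.
Proof.
move=> /compact_closed -/(_ (@norm_hausdorff _ (R * R)%type)) cA.
rewrite -(setCK A); apply: measurableC; apply: open_measurable_plane.
exact: closed_openC.
Qed.

Lemma continuous_pairing (w : R * R) : continuous (pairing w).
Proof.
move=> a; apply: cvgD; apply: cvgM; [exact: cvg_cst|exact: cvg_fst|exact: cvg_cst|exact: cvg_snd].
Qed.

Lemma measurable_pairing (w : R * R) : measurable_fun setT (pairing w).
Proof.
by apply: measurable_funD; apply: measurable_funM.
Qed.

End plane.

(** * Negligibility of the complement of the support *)

Section support.
Context {R : realType} (mu : {finite_measure set (R * R)%type -> \bar R}).

(** Each point off the support has a null open neighbourhood, hence lies in a null member of the
    countable base; so all the mass of [A] sits on the support. *)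
Lemma supp_measure0 (A : set (R * R)) : measurable A -> mu (supp mu `&` A) = 0%E ->
  measurable (supp mu) -> mu A = 0%E.
Proof.
move=> mA mu0 msupp; have [B [mB BA]] := @countable_base_plane R.
(* Only the null base sets are kept, the others being replaced by [set0], so the countable union is
   negligible. *)
have nS : mu.-negligible (\bigcup_n (if `[< mu (B n) = 0%E >] then B n else set0)).
  apply: negligible_bigcup => n; case: asboolP => [B0|_]; last exact: negligible_set0.
  by exists (B n); split.
have {}nS : mu.-negligible (~` supp mu).
  apply: negligibleS nS => x /= /existsNP[U /not_implyP[oU /not_implyP[Ux U0]]].
  have [n Bnx BnU] := BA U x oU Ux; exists n => //; case: asboolP => // -[].
  apply/eqP; rewrite eq_le measure_ge0 andbT.
  rewrite (le_trans (le_measure _ _ _ BnU)) ?inE//; first exact: open_measurable_plane.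
  by rewrite leNgt; apply/negP.
have mSA : measurable (supp mu `&` A)  by exact: measurableI.
have nSA : mu.-negligible (supp mu `&` A) by exists (supp mu `&` A); split=> //; exact: mu0.
apply: (measure_negligible mA); apply: negligibleS (negligibleU nSA nS).
by move=> x Ax; have [sx|nsx] := pselect (supp mu x); [left|right].
Qed.

End support.

(** * Attainment of the maximum, and bounds and continuity of Lambda *)

Section Laplace_transform.
Context {R : realType} {mu : {finite_measure set (R * R)%type -> \bar R}}.
Hypotheses (supp_compact : compact (supp mu)) (mu_neq0 : mu setT != 0%E).
Variable w : R * R.

Let msupp : measurable (supp mu) := compact_measurable_plane _ supp_compact.

(** An empty support would force [mu] to vanish; on a nonempty compact support the continuous
    pairing has a maximum. *)
Lemma H_mu_attained : exists2 a, supp mu a & Delta mu w a = 0.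
Proof.
have supp0 : supp mu !=set0.
  apply/set0P/negP => /eqP S0; move/eqP: mu_neq0; apply.
  by apply: supp_measure0 => //; rewrite S0 set0I measure0.
have [a /set_mem Sa aP] := compact_EVT_max supp0 supp_compact
  (continuous_subspaceT (continuous_pairing w)).
exists a => //; apply/eqP; rewrite subr_eq0 eq_le; apply/andP; split.
  by apply: ge_sup => [|_ [b Sb <-]]; [exists (pairing w a), a|exact/aP/mem_set].
apply: ub_le_sup; last by exists a.
by exists (pairing w a) => _ [b Sb <-]; exact/aP/mem_set.
Qed.

Lemma Delta_ge0 a : supp mu a -> 0 <= Delta mu w a.
Proof.
move=> Sa; rewrite subr_ge0; apply: ub_le_sup; last by exists a.
have [b Sb b0] := H_mu_attained.
have [M [_ MP]] := compact_bounded (continuous_compact (continuous_subspaceT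
  (continuous_pairing w)) supp_compact).
(* [MP] applies only to numbers strictly above [M], hence [M + 1]. *)
by exists (M + 1) => x /(MP (M + 1)); rewrite ltrDl ltr01 => /(_ isT); apply: le_trans; exact: ler_norm.
Qed.

Lemma measurable_Delta (A : set (R * R)) : measurable_fun A (Delta mu w).
Proof.
by apply: measurable_funTS; apply: measurable_funB => //; exact: measurable_pairing.
Qed.

Lemma measurable_expR_Delta s (A : set (R * R)) :
  measurable_fun A (fun a => expR (- s * Delta mu w a)).
Proof.
apply: measurableT_comp => //; apply: measurable_funM => //.
exact: measurable_Delta.
Qed.

Lemma expR_Delta_le1 s a : 0 <= s -> supp mu a -> expR (- s * Delta mu w a) <= 1.
Proof.
by move=> s0 Sa; rewrite -[leRHS]expR0 ler_expR mulNr oppr_le0 mulr_ge0 ?Delta_ge0.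
Qed.

Lemma integrable_Lambda s : 0 <= s ->
  mu.-integrable (supp mu) (EFin \o (fun a => expR (- s * Delta mu w a))).
Proof.
move=> s0; apply: le_integrable (finite_measure_integrable_cst mu 1 msupp) => //.
  by apply/measurable_EFinP; exact: measurable_expR_Delta.
move=> a Sa /=; rewrite lee_fin normr1 ger0_norm ?expR_ge0//.
exact: expR_Delta_le1.
Qed.

Lemma EFin_Lambda s : 0 <= s ->
  (Lambda mu w s)%:E = (\int[mu]_(a in supp mu) (expR (- s * Delta mu w a))%:E)%E.
Proof.
by move=> s0; rewrite fineK//; apply: integrable_fin_num => //; exact: integrable_Lambda.
Qed.

Lemma Lambda_ge0 s : 0 <= Lambda mu w s.
Proof. by apply: Rintegral_ge0 => a _; exact: expR_ge0. Qed.

Lemma Lambda_le s : 0 <= s -> Lambda mu w s <= fine (mu (supp mu)).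
Proof.
move=> s0; rewrite -lee_fin EFin_Lambda// fineK ?fin_num_measure//.
rewrite -[leRHS]mul1e -integral_cst//; apply: ge0_le_integral_nomeas => a Sa.
  by rewrite lee_fin expR_ge0.
by rewrite lee_fin expR_Delta_le1.
Qed.

(** Where [Delta] is below [delta] the integrand is at least e^(-s delta). This open set contains a
    maximiser of the pairing, so the part of the support inside it has positive mass, and that mass
    is [c]. *)
Lemma Lambda_lower (delta : R) : 0 < delta ->
  exists2 c, 0 < c & forall s, 0 <= s -> c * expR (- s * delta) <= Lambda mu w s.
Proof.
move=> delta0; have [a Sa a0] := H_mu_attained.
pose U := [set b | Delta mu w b < delta].
have cD : continuous (Delta mu w).
  by move=> x; apply: cvgB; [exact: cvg_cst|exact: continuous_pairing].
have oU : open U.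
  rewrite (_ : U = Delta mu w @^-1` [set x | x < delta])//.
  by apply: open_comp => //; exact: open_lt.
have mU : measurable U by exact: open_measurable_plane.
have mSU : measurable (supp mu `&` U) by exact: measurableI.
(* If the intersection were null, so would be the whole neighbourhood [U] of the support point [a],
   against the definition of the support. *)
have mu0 : mu (supp mu `&` U) != 0%E.
  apply/negP => /eqP /(supp_measure0 mu U mU) -/(_ msupp) U0.
  have Ua : U a by rewrite /U/= a0.
  by have := Sa U oU Ua; rewrite U0 ltxx.
exists (fine (mu (supp mu `&` U))).
  by rewrite fine_gt0// lt0e mu0 measure_ge0/= ltey_eq fin_num_measure.
move=> s s0; rewrite -lee_fin EFin_Lambda// EFinM fineK ?fin_num_measure// muleC.
rewrite -integral_cst//.
apply: (@le_trans _ _ (\int[mu]_(a in supp mu `&` U) (expR (- s * Delta mu w a))%:E)%E).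
  apply: ge0_le_integral_nomeas => [b _|b [_ /= Ub]]; rewrite lee_fin ?expR_ge0//.
  by rewrite ler_expR !mulNr lerN2 ler_wpM2l// ltW.
apply: ge0_subset_integral => //.
by apply/measurable_EFinP; exact: measurable_expR_Delta.
Qed.

(** Dominated convergence: for parameters in ]0, s + 1[ the integrand is at most 1, which is
    integrable because [mu] is finite. *)
Lemma continuous_Lambda s : 0 < s -> {for s, continuous (Lambda mu w)}.
Proof.
move=> s0; apply: (@continuity_under_integral R _ _ mu
  (fun s a => expR (- s * Delta mu w a)) (supp mu) msupp 0 (s + 1) _ _ (cst 1)).
- by move=> x /=; rewrite in_itv/= => /andP[/ltW x0 _]; exact: integrable_Lambda.
- apply: aeW => a Sa x _; apply: continuous_comp; last exact: continuous_expR.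
  by apply: cvgM; [apply: cvgN; exact: cvg_id|exact: cvg_cst].
- exact: finite_measure_integrable_cst.
- move=> x /=; rewrite in_itv/= => /andP[/ltW x0 _]; apply: aeW => a Sa /=.
  by rewrite ger0_norm ?expR_ge0//; exact: expR_Delta_le1.
- by rewrite inE/= in_itv/= s0/=; lra.
Qed.

End Laplace_transform.

(** * The change of variable r = e^(-s) and exponential tails *)

Section log_substitution.
Context {R : realType}.

(** Substitution is done on compact pieces, from [e^(-(a+n)), r0] to [a, a+n], and monotone
    convergence in n finishes; both sides may be infinite. *)
Lemma integral_log_substitution (phi : R -> R) (r0 : R) : 0 < r0 < 1 ->
  (forall s, 0 < s -> {for s, continuous phi}) -> (forall s, 0 <= phi s) ->
  (\int[lebesgue_measure]_(r in `]0%R, r0[) (r^-1 * phi (- ln r))%:E =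
   \int[lebesgue_measure]_(s in `[(- ln r0)%R, +oo[) (phi s)%:E)%E.
Proof.
move=> /andP[r0_gt0 r0_lt1] cphi phi0; set a := - ln r0.
have a0 : 0 < a by rewrite oppr_gt0 ln_lt0// r0_gt0.
pose F : R -> R := expR \o -%R; pose G (r : R) := r^-1 * phi (- ln r).
have FK s : - ln (F s) = s by rewrite /F/= expRK opprK.
have Fa : F a = r0 by rewrite /F/= /a opprK lnK.
have F0 s : 0 < F s by exact: expR_gt0.
have FS x y : (F x < F y) = (y < x) by rewrite /F/= ltr_expR ltrN2.
have dF (x : R) : is_derive x (1 : R) F (- F x).
  by apply: is_derive_eq; rewrite /F/= mulrN1.
have F'E : F^`()%classic = - F.
  by apply/funext => x; rewrite derive1E; have [_ ->] := dF x.
have cF : continuous F.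
  by move=> x; apply/differentiable_continuous/derivable1_diffP; have [] := dF x.
have cF' : continuous F^`()%classic by rewrite F'E => x; apply: cvgN; exact: cF.
have cG r : 0 < r < 1 -> {for r, continuous G}.
  move=> /andP[r_gt0 r_lt1]; apply: cvgM; first by apply: cvgV; [rewrite gt_eqF|exact: cvg_id].
  apply: (@continuous_comp _ _ _ (fun r => - ln r) phi).
    by apply: cvgN; exact: continuous_ln.
  by apply: cphi; rewrite oppr_gt0 ln_lt0// r_gt0.
have subst n : (\int[lebesgue_measure]_(r in `[F (a + n%:R)%R, r0]) (G r)%:E =
    \int[lebesgue_measure]_(s in `[a, (a + n%:R)%R]) (phi s)%:E)%E.
  rewrite -{1}Fa integration_by_substitution_decreasing.
  (* As F' = -F, the Jacobian F(s) cancels the factor r^(-1) of [G]. *)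
  - apply: eq_integral => s _; rewrite F'E opprK.
    have -> : ((G \o F) * F) s = (F s)^-1 * phi (- ln (F s)) * F s by [].
    by rewrite FK mulrAC mulVf ?mul1r// gt_eqF.
  - by rewrite lerDl.
  - by move=> x y _ _; rewrite FS.
  - by move=> x _; exact: cF'.
  - by apply/cvg_ex; exists (F^`()%classic a); apply: cvg_at_right_filter; exact: cF'.
  - by apply/cvg_ex; exists (F^`()%classic (a + n%:R)); apply: cvg_at_left_filter; exact: cF'.
  - split; first by move=> x _; have [] := dF x.
      by apply: cvg_at_right_filter; exact: cF.
    by apply: cvg_at_left_filter; exact: cF.
  - apply: continuous_in_subspaceT => r; rewrite inE/= in_itv/= Fa => /andP[Fr rr0].
    by apply: cG; rewrite (lt_le_trans (F0 _) Fr) (le_lt_trans rr0).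
have mphi : measurable_fun (`]0, +oo[%classic : set R) phi.
  apply: open_continuous_measurable_fun => // s; rewrite inE/= in_itv/= andbT.
  exact: cphi.
have mG : measurable_fun (`]0, 1[%classic : set R) G.
  apply: open_continuous_measurable_fun => // r; rewrite inE/= in_itv/=.
  exact: cG.
have Ule : {homo (fun n => `[F (a + n%:R), r0]%classic) : n m / (n <= m)%N >-> (n <= m)%O}.
  move=> n m nm; apply/subsetPset => r /=; rewrite !in_itv/= => /andP[Fr ->]; rewrite andbT.
  by apply: le_trans Fr; rewrite leNgt FS -leNgt lerD2l ler_nat.
have limG : (\int[lebesgue_measure]_(r in `[F (a + n%:R)%R, r0]) (G r)%:E)%E @[n --> \oo]
    --> (\int[lebesgue_measure]_(r in `]0%R, r0]) (G r)%:E)%E.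
  rewrite (_ : `]0, r0]%classic = \bigcup_n `[F (a + n%:R), r0]%classic).
    apply: ge0_nondecreasing_set_cvg_integral => //.
      move=> n; apply/measurable_EFinP; apply: measurable_funS mG => // r /=.
      rewrite !in_itv/= => /andP[Fr rr0].
      by rewrite (lt_le_trans (F0 _) Fr) (le_lt_trans rr0).
    move=> n r /=; rewrite in_itv/= => /andP[Fr _].
    by rewrite lee_fin mulr_ge0// invr_ge0 (le_trans _ Fr)// ltW.
  apply/seteqP; split=> [r /=|r [n _] /=]; rewrite !in_itv/= => /andP[Fr rr0].
    (* [r] lies in the n-th piece as soon as n >= -ln r, since then e^(-(a+n)) <= e^(-n) <= r. *)
    exists (Num.trunc (- ln r)).+1 => //=; rewrite in_itv/= rr0 andbT.
    rewrite -[leRHS]lnK ?posrE// /F/= ler_expR lerNl.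
    have /ltW := truncnS_gt (- ln r); move/le_trans; apply.
    by rewrite lerDr ltW.
  by rewrite rr0 andbT (lt_le_trans (F0 _) Fr).
have limphi : (\int[lebesgue_measure]_(s in `[a, (a + n%:R)%R]) (phi s)%:E)%E @[n --> \oo]
    --> (\int[lebesgue_measure]_(s in `[a, +oo[) (phi s)%:E)%E.
  rewrite itv_bndy_bigcup_BRight.
  apply: ge0_nondecreasing_set_cvg_integral => //.
  - move=> n m nm; apply/subsetPset => r /=; rewrite !in_itv/= => /andP[->/= rn].
    by apply: (le_trans rn); rewrite lerD2l ler_nat.
  - move=> n; apply/measurable_EFinP; apply: measurable_funS mphi => // r /=.
    by rewrite !in_itv/= andbT => /andP[ar _]; exact: lt_le_trans ar.
  - by move=> n r _; rewrite lee_fin.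
have mG0 : measurable_fun (`]0, r0[%classic : set R) (EFin \o G).
  apply/measurable_EFinP; apply: measurable_funS mG => // r /=.
  by rewrite !in_itv/= => /andP[-> rr0]/=; exact: lt_trans rr0 _.
(* The endpoint [r0] is null, so the half-closed interval reached by the limit gives the same
   integral. *)
rewrite integral_itv_bndo_bndc//.
by move: limG; rewrite (eq_cvg _ _ subst) => limG; exact: (cvg_unique _ limG limphi).
Qed.

(** The antiderivative -e^(-bs)/b tends to 0 at infinity. *)
Lemma integral_expRN_lty (b a : R) : 0 < b ->
  (\int[lebesgue_measure]_(s in `[a, +oo[) (expR (- b * s))%:E < +oo)%E.
Proof.
move=> b0; pose F (s : R) := - b^-1 * expR (- b * s).
have dF (x : R) : is_derive x (1 : R) F (expR (- b * x)).
  apply: is_derive_eq; rewrite /GRing.scale/= !mulr1.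
  by rewrite mulrCA mulrNN mulVf ?mulr1// gt_eqF.
have cE : continuous (fun s => expR (- b * s)).
  by move=> x; apply: continuous_comp; [exact: mulrl_continuous|exact: continuous_expR].
rewrite (@ge0_continuous_FTC2y _ _ F a 0).
- by rewrite -EFinB ltry.
- by move=> x _; exact: expR_ge0.
- exact: continuous_subspaceT.
- rewrite -(mulr0 (- b^-1)); apply: cvgM; first exact: cvg_cst.
  have bs : b * s @[s --> +oo] --> +oo by exact: gt0_cvgMry.
  have -> : (fun s => expR (- b * s)) = (fun y => expR (- y)) \o *%R b.
    by apply/funext => s /=; rewrite mulNr.
  exact: cvg_comp bs (@cvgr_expR R).
- by move=> x _; have [] := dF x.
- apply: cvg_at_right_filter; apply: cvgM; [exact: cvg_cst|exact: cE].
- by move=> x _; rewrite derive1E; have [] := dF x.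
Qed.

End log_substitution.

(** This extracts, from the joint measurability of [u], measurability in the exponent at a fixed
    point of the chart. *)
Lemma measurable_fun_section2 d1 d2 d3 (T1 : measurableType d1) (T2 : measurableType d2)
    (T3 : measurableType d3) (A : set T1) (B : set T2) (f : T1 * T2 -> T3) (y : T2) :
  measurable A -> measurable B -> B y -> measurable_fun (A `*` B) f ->
  measurable_fun A (fun x => f (x, y)).
Proof.
move=> mA mB By mf.
apply: (@measurable_comp _ _ _ _ _ _ (A `*` B) f A (fun x => (x, y))) => //.
- exact: measurableX.
- by move=> _ [x Ax <-].
- exact: measurable_funTS (pair2_measurable y).
Qed.

(** * Chart coordinates, the monomial curve and its velocity *)

Section chart.
Context {R : realType} {k : nat}.
Implicit Types (V : set 'rV[R]_k) (w : R * R) (z : 'rV[R]_k).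

Lemma coord_x_chart_point x y z : coord_x (chart_point x y z) = x :> R.
Proof. by rewrite /coord_x /chart_point row_mxEl mxE. Qed.

Lemma coord_y_chart_point x y z : coord_y (chart_point x y z) = y :> R.
Proof. by rewrite /coord_y /chart_point row_mxEl mxE. Qed.

Lemma coord_z_chart_point x y z : coord_z (chart_point x y z) = z :> 'rV[R]_k.
Proof. by rewrite /coord_z /chart_point row_mxKr. Qed.

Lemma open_chart_interior (eps : R) V : open V -> open (chart_interior eps V).
Proof.
move=> oV; have oI : open [set x : R | 0 < x < eps].
  rewrite (_ : [set _ | _] = `]0, eps[%classic); first exact: interval_open.
  by apply/seteqP; split => x /=; rewrite in_itv.
rewrite (_ : chart_interior _ _ = coord_x @^-1` [set x : R | 0 < x < eps] `&`
    coord_y @^-1` [set x : R | 0 < x < eps] `&` coord_z @^-1` V); last first.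
  by apply/seteqP; split => [p []|p [[]]].
apply: openI; first by apply: openI; apply: open_comp => // p _; exact: coord_continuous.
apply: open_comp => // p _.
(* The entries of [coord_z p] are entries of [p], so for the sup norm the same radius works. *)
move=> A /nbhs_ballP[e /= e0 eA]; apply/nbhs_ballP; exists e => //= q pq; apply: eA.
by case: pq => _ pq; split => // i j; rewrite !mxE; exact: pq.
Qed.

Lemma measurable_chart_interior (eps : R) V : open V ->
  measurable (chart_interior eps V : set (g_sigma_algebraType (@open 'rV[R]_(2 + k)))).
Proof. by move=> oV; apply: sub_sigma_algebra; exact: open_chart_interior. Qed.

Lemma chart_interior_subset (eps : R) V : chart_interior eps V `<=` chart eps V.
Proof.
by move=> p [/andP[/ltW x0 xe] /andP[/ltW y0 ye] Vz]; split; rewrite ?x0 ?y0.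
Qed.

Lemma monomial_curve_interior (eps : R) V w z (r0 r : R) :
  0 < w.1 /\ 0 < w.2 -> V z -> r0 `^ w.1 < eps /\ r0 `^ w.2 < eps ->
  0 < r < r0 -> chart_interior eps V (monomial_curve w z r).
Proof.
move=> [p0 q0] Vz [r0p r0q] /andP[r_gt0 rr0].
have pow_lt c : 0 < c -> r `^ c < r0 `^ c.
  by move=> c0; rewrite gt0_ltr_powR// nnegrE ltW// (lt_trans r_gt0).
split; rewrite ?coord_x_chart_point ?coord_y_chart_point ?coord_z_chart_point//.
  by rewrite powR_gt0//= (lt_trans (pow_lt _ p0)).
by rewrite powR_gt0//= (lt_trans (pow_lt _ q0)).
Qed.

Lemma derive1_monomial_curve w z (r : R) : 0 < r ->
  (monomial_curve w z)^`()%classic r =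
  chart_point (w.1 * r `^ (w.1 - 1)) (w.2 * r `^ (w.2 - 1)) 0.
Proof.
move=> r0.
(* The velocity is found entry by entry: two powers of r, and constants in the z block. *)
have d i j : is_derive r (1 : R) (fun t => monomial_curve w z t i j)
   (chart_point (w.1 * r `^ (w.1 - 1)) (w.2 * r `^ (w.2 - 1)) (0 : 'rV[R]_k) i j).
  rewrite /monomial_curve /chart_point; case: (split_ordP j) => l ->.
    under eq_fun do rewrite row_mxEl mxE; rewrite row_mxEl mxE.
    by case: ifP => _; exact: is_derive1_powR.
  by under eq_fun do rewrite row_mxEr; rewrite row_mxEr mxE; exact: is_derive_cst.
rewrite derive1E derive_mx; last by apply/derivable_mxP => i j; have [] := d i j.
by apply/matrixP => i j; rewrite mxE; have [_ ->] := d i j.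
Qed.

Lemma inner_scale (f : 'rV[R]_(2 + k) -> R) g p v :
  inner (scale_metric f g) p v v = f p * inner g p v v.
Proof. by rewrite /inner /scale_metric -scalemxAr -scalemxAl mxE. Qed.

Lemma inner_euclidean_chart_point p x y :
  inner euclidean_metric p (chart_point x y (0 : 'rV[R]_k)) (chart_point x y 0) =
  x ^+ 2 + y ^+ 2.
Proof.
rewrite /inner /euclidean_metric mulmx1 mxE.
under eq_bigr do rewrite [X in _ * X]mxE -expr2.
rewrite big_split_ord/= [X in _ + X]big1 ?addr0 => [|i _]; last first.
  by rewrite /chart_point row_mxEr mxE expr0n.
by rewrite 2!big_ord_recl big_ord0 addr0 /chart_point !row_mxEl !mxE.
Qed.

End chart.

(** * Two-sided bounds on the conformal factor along the curve *)

Section conformal_factor.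
Context {R : realType} {k : nat} {V : set 'rV[R]_k} {eps : R}.
Context {mu : {finite_measure set (R * R)%type -> \bar R}}.
Context {u : R * R -> 'rV[R]_(2 + k) -> R} {cu Cu : R} {w : R * R}.
Hypotheses (V_open : open V) (supp_compact : compact (supp mu))
  (mu_neq0 : mu setT != 0%E)
  (u_gt0 : forall a p, supp mu a -> chart_interior eps V p -> 0 < u a p)
  (u_meas : measurable_fun
     (supp mu `*` chart_interior eps V :
        set ((R * R) * g_sigma_algebraType (@open 'rV[R]_(2 + k)))%type)
     (fun ap : (R * R) * g_sigma_algebraType (@open 'rV[R]_(2 + k)) =>
        u ap.1 ap.2))
  (cu_gt0 : 0 < cu)
  (u_bounds : {ae mu, forall a, supp mu a ->
     forall p, chart_interior eps V p -> cu <= u a p <= Cu}).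

(** With s = -ln r the left side is e^(s <w,a>), and <w,a> = H - Delta(a). *)
Lemma monomial_weight (r : R) (a : R * R) : 0 < r ->
  (r `^ w.1) `^ (- a.1) * (r `^ w.2) `^ (- a.2) =
  expR (- ln r * H_mu mu w) * expR (- - ln r * Delta mu w a).
Proof.
move=> r0; rewrite -!powRrM /powR gt_eqF// -!expRD; congr expR.
by rewrite /Delta /pairing; ring.
Qed.

(** The almost everywhere bounds on [u] are integrated against the monomial weight. The absolute
    value makes the upper constant nonnegative whatever the sign of [Cu]. *)
Lemma F_mu_monomial_bounds (r : R) (p : 'rV[R]_(2 + k)) :
  0 < r <= 1 -> chart_interior eps V p ->
  coord_x p = r `^ w.1 -> coord_y p = r `^ w.2 ->
  let X := expR (- ln r * H_mu mu w) * Lambda mu w (- ln r) in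
  cu * X <= F_mu mu u p <= `|Cu| * X.
Proof.
move=> /andP[r0 r1] Up px py /=; set s := - ln r; set X := expR _ * _.
have s0 : 0 <= s by rewrite oppr_ge0 ln_le0.
have msupp : measurable (supp mu) by exact: compact_measurable_plane.
pose e a := expR (s * H_mu mu w) * expR (- s * Delta mu w a).
have me : measurable_fun (supp mu) e.
  by apply: measurable_funM => //; exact: measurable_expR_Delta.
have e0 a : 0 <= e a by rewrite mulr_ge0// expR_ge0.
pose f a := u a p * coord_x p `^ (- a.1) * coord_y p `^ (- a.2).
have fE a : f a = u a p * e a by rewrite /f px py -mulrA monomial_weight.
have mf : measurable_fun (supp mu) f.
  rewrite (_ : f = fun a => u a p * e a); last exact/funext.
  apply: measurable_funM => //.
  have mI := measurable_chart_interior eps _ V_open.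
  exact: (measurable_fun_section2 _ _ _ _ _ _ _ _ _ _ msupp mI Up u_meas).
have f0 a : supp mu a -> (0 <= (f a)%:E)%E.
  by move=> Sa; rewrite lee_fin fE mulr_ge0// ltW// u_gt0.
have int_e c : 0 <= c -> (\int[mu]_(a in supp mu) (c * e a)%:E = (c * X)%:E)%E.
  move=> c0; under eq_integral do rewrite /e mulrA EFinM.
  rewrite ge0_integralZl_EFin//.
  - by rewrite -EFin_Lambda// -EFinM mulrA.
  - by apply/measurable_EFinP; exact: measurable_expR_Delta.
  - by rewrite mulr_ge0// expR_ge0.
have lower : ((cu * X)%:E <= \int[mu]_(a in supp mu) (f a)%:E)%E.
  rewrite -int_e; last exact: ltW.
  apply: ae_ge0_le_integral => //.
  - by move=> a _; rewrite lee_fin mulr_ge0// ltW.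
  - by apply/measurable_EFinP; apply: measurable_funM.
  - exact/measurable_EFinP.
  - apply: filterS u_bounds => a /[apply] /(_ p Up) /andP[cua _].
    by rewrite lee_fin fE ler_wpM2r.
have upper : (\int[mu]_(a in supp mu) (f a)%:E <= (`|Cu| * X)%:E)%E.
  rewrite -int_e//; apply: ae_ge0_le_integral => //.
  - exact/measurable_EFinP.
  - by move=> a _; rewrite lee_fin mulr_ge0.
  - by apply/measurable_EFinP; apply: measurable_funM.
  - apply: filterS u_bounds => a /[apply] /(_ p Up) /andP[_ uaC].
    by rewrite lee_fin fE ler_wpM2r// (le_trans uaC)// ler_norm.
(* [F_mu] is the [fine] part of this integral, which would turn +oo into 0; finiteness is what lets
   the bounds transfer. *)
have ffin : (\int[mu]_(a in supp mu) (f a)%:E)%E \is a fin_num.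
  rewrite ge0_fin_numE; last exact: integral_ge0.
  by rewrite (le_lt_trans upper)// ltry.
by rewrite /F_mu/= -!lee_fin /Rintegral fineK// lower upper.
Qed.

End conformal_factor.

(** * Convergence of the model integral according to the sign of b *)

Section integral_criterion.
Context {R : realType} {mu : {finite_measure set (R * R)%type -> \bar R}}.
Hypotheses (supp_compact : compact (supp mu)) (mu_neq0 : mu setT != 0%E).
Variable w : R * R.

(** In the variable s = -ln r this is, up to constant factors, r times the speed of the curve when b
    = m - H/2. *)
Definition speed_profile (b s : R) : R := expR (- b * s) * Num.sqrt (Lambda mu w s).

Lemma speed_profile_ge0 b s : 0 <= speed_profile b s.
Proof. by rewrite mulr_ge0// expR_ge0. Qed.

Lemma continuous_sqrt_Lambda s : 0 < s ->
  {for s, continuous (fun s => Num.sqrt (Lambda mu w s))}.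
Proof.
move=> s0; apply: (@continuous_comp _ _ _ (Lambda mu w)); last exact: sqrt_continuous.
exact: continuous_Lambda.
Qed.

Lemma continuous_speed_profile b s : 0 < s -> {for s, continuous (speed_profile b)}.
Proof.
move=> s0; apply: cvgM; last exact: continuous_sqrt_Lambda.
by apply: continuous_comp; [exact: mulrl_continuous|exact: continuous_expR].
Qed.

Lemma measurable_sqrt_Lambda (s : R) : 0 <= s ->
  measurable_fun (`[s, +oo[%classic : set R) (fun s => Num.sqrt (Lambda mu w s)).
Proof.
(* Continuity is available only at positive arguments, so the left endpoint, possibly 0, is first
   removed. *)
move=> s0; apply/measurable_fun_itv_obnd_cbndP.
apply: open_continuous_measurable_fun => // t; rewrite inE/= in_itv/= andbT => st.
by apply: continuous_sqrt_Lambda; exact: le_lt_trans st.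
Qed.

Lemma sqrt_Lambda_le s : 0 <= s ->
  Num.sqrt (Lambda mu w s) <= Num.sqrt (fine (mu (supp mu))).
Proof. by move=> s0; rewrite ler_wsqrtr// Lambda_le. Qed.

(** Lambda is bounded by the mass of the support, so the profile is at most a multiple of
    e^(-bs). *)
Lemma integral_speed_profile_lty b a : 0 <= a -> 0 < b ->
  (\int[lebesgue_measure]_(s in `[a, +oo[) (speed_profile b s)%:E < +oo)%E.
Proof.
move=> a0 b0; pose M := Num.sqrt (fine (mu (supp mu))).
have : (\int[lebesgue_measure]_(s in `[a, +oo[) (M%:E * (expR (- b * s))%:E) < +oo)%E.
  rewrite ge0_integralZl_EFin//.
  - by rewrite lte_mul_pinfty// ?lee_fin ?sqrtr_ge0//; exact: integral_expRN_lty.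
  - by apply/measurable_EFinP; apply: measurableT_comp.
  - exact: sqrtr_ge0.
apply: le_lt_trans; apply: ge0_le_integral_nomeas => s /=; rewrite in_itv/= andbT => sa.
  by rewrite lee_fin speed_profile_ge0.
rewrite -EFinM lee_fin mulrC /speed_profile ler_wpM2l ?expR_ge0// sqrt_Lambda_le//.
exact: le_trans sa.
Qed.

(** Taking delta = -2b in [Lambda_lower] gives a decay that exactly offsets the growth of e^(-bs):
    the profile stays above the constant sqrt(c) on a half-line. *)
Lemma integral_speed_profile_pinfty b a : 0 <= a -> b < 0 ->
  (\int[lebesgue_measure]_(s in `[a, +oo[) (speed_profile b s)%:E = +oo)%E.
Proof.
move=> a0 b0; have b20 : 0 < - b *+ 2 by rewrite mulrn_wgt0// oppr_gt0.
have [c c0 cL] := Lambda_lower supp_compact mu_neq0 w _ b20.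
apply/eqP; rewrite -leye_eq.
rewrite (_ : +oo = \int[lebesgue_measure]_(s in `[a, +oo[) (Num.sqrt c)%:E)%E; last first.
  rewrite integral_cst//= lebesgue_measure_itv/= ltry.
  by rewrite addye// gt0_muley// lte_fin sqrtr_gt0.
apply: ge0_le_integral_nomeas => s /=; rewrite in_itv/= andbT => sa; rewrite lee_fin ?sqrtr_ge0//.
have s0 : 0 <= s by exact: le_trans sa.
rewrite /speed_profile -[expR _]ger0_norm ?expR_ge0// -sqrtr_sqr -sqrtrM ?sqr_ge0//.
rewrite ler_wsqrtr//; apply: le_trans (ler_wpM2l (sqr_ge0 _) (cL s s0)).
rewrite mulrCA -expRM_natl -expRD (_ : _ + _ = 0) ?expR0 ?mulr1//.
by rewrite -mulr_natl; ring.
Qed.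

(** The bounded piece [a, b[ contributes a finite amount because Lambda is bounded. *)
Lemma integral_sqrt_Lambda_tail a b : 0 <= a -> a <= b ->
  (\int[lebesgue_measure]_(s in `[a, +oo[) (Num.sqrt (Lambda mu w s))%:E < +oo)%E <->
  (\int[lebesgue_measure]_(s in `[b, +oo[) (Num.sqrt (Lambda mu w s))%:E < +oo)%E.
Proof.
move=> a0 ab; have mL := measurable_sqrt_Lambda _ a0.
have E : `[a, +oo[%classic = `[a, b[%classic `|` `[b, +oo[%classic :> set R.
  by rewrite -itv_bndbnd_setU//= bnd_simp.
rewrite E ge0_integral_setU//; last 2 first.
- by rewrite -E; exact/measurable_EFinP.
- apply/disj_setPS => s [] /=; rewrite !in_itv/= andbT => /andP[_ sb] bs.
  by move: sb; rewrite ltNge bs.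
have fin : (\int[lebesgue_measure]_(s in `[a, b[) (Num.sqrt (Lambda mu w s))%:E < +oo)%E.
  apply: (@le_lt_trans _ _ (\int[lebesgue_measure]_(s in `[a, b[)
      (Num.sqrt (fine (mu (supp mu))))%:E)%E).
    apply: ge0_le_integral_nomeas => s /=; rewrite in_itv/= => /andP[sa _].
      by rewrite lee_fin sqrtr_ge0.
    by rewrite lee_fin sqrt_Lambda_le// (le_trans a0).
  rewrite integral_cst//= lebesgue_measure_itv/=.
  by case: ifP => _; rewrite ?mule0// -EFinB -EFinM ltry.
split=> [|bfin]; last by rewrite lte_add_pinfty.
by apply: le_lt_trans; rewrite leeDr// integral_ge0.
Qed.

End integral_criterion.

(** * Comparison of the length with the model integral *)

Section length_comparison.
Context {R : realType} {k : nat} {V : set 'rV[R]_k} {eps : R}.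
Context {g0 : 'rV[R]_(2 + k) -> 'M[R]_(2 + k)} {c0 C0 : R}.
Context {mu : {finite_measure set (R * R)%type -> \bar R}}.
Context {u : R * R -> 'rV[R]_(2 + k) -> R} {cu Cu : R} {w : R * R}.
Context {z : 'rV[R]_k} {r0 : R}.
Hypotheses (V_open : open V) (c0_gt0 : 0 < c0) (c0_le_C0 : c0 <= C0)
  (g0_lower : metric_le (chart eps V)
     (scale_metric (fun=> c0) euclidean_metric) g0)
  (g0_upper : metric_le (chart eps V)
     g0 (scale_metric (fun=> C0) euclidean_metric))
  (mu_neq0 : mu setT != 0%E)
  (supp_compact : compact (supp mu))
  (u_gt0 : forall a p, supp mu a -> chart_interior eps V p -> 0 < u a p)
  (u_meas : measurable_fun
     (supp mu `*` chart_interior eps V :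
        set ((R * R) * g_sigma_algebraType (@open 'rV[R]_(2 + k)))%type)
     (fun ap : (R * R) * g_sigma_algebraType (@open 'rV[R]_(2 + k)) =>
        u ap.1 ap.2))
  (cu_gt0 : 0 < cu)
  (u_bounds : {ae mu, forall a, supp mu a ->
     forall p, chart_interior eps V p -> cu <= u a p <= Cu})
  (F_gt0 : forall p, chart_interior eps V p -> 0 < F_mu mu u p)
  (w_gt0 : 0 < w.1 /\ 0 < w.2) (z_V : V z) (r0_itv : 0 < r0 < 1)
  (r0_eps : r0 `^ w.1 < eps /\ r0 `^ w.2 < eps).

Let m := Num.min w.1 w.2.
Let b := m - H_mu mu w / 2.
(** The model speed; the factor r^(-1) is absorbed by dr = -r ds. *)
Let q r := r^-1 * speed_profile (mu := mu) w b (- ln r).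
Let speed r := Num.sqrt (inner (scale_metric (F_mu mu u) g0) (monomial_curve w z r)
  ((monomial_curve w z)^`()%classic r) ((monomial_curve w z)^`()%classic r)).

Lemma sqr_powRB1 (c r : R) : 0 < r ->
  (c * r `^ (c - 1)) ^+ 2 = c ^+ 2 * (r^-1 ^+ 2 * expR (- (2 * c) * - ln r)).
Proof.
move=> r_gt0; rewrite /powR gt_eqF// (_ : (c - 1) * ln r = - ln r + - c * - ln r); last by ring.
rewrite expRD expRN lnK ?posrE// !exprMn; congr (_ * (_ * _)).
by rewrite -expRM_natl; congr expR; ring.
Qed.

(** For r < 1 the smaller exponent dominates: both squares are controlled by the power with exponent
    m, and the square whose exponent is m already gives the lower bound. *)
Lemma euclidean_speed_bounds (r : R) : 0 < r < 1 ->
  let E := r^-1 ^+ 2 * expR (- (2 * m) * - ln r) in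
  m ^+ 2 * E <= (w.1 * r `^ (w.1 - 1)) ^+ 2 + (w.2 * r `^ (w.2 - 1)) ^+ 2
    <= (w.1 ^+ 2 + w.2 ^+ 2) * E.
Proof.
move=> /andP[r_gt0 r_lt1] /=; set E := _ * expR _.
have E0 : 0 <= E by rewrite mulr_ge0 ?sqr_ge0 ?expR_ge0.
have le_E c : m <= c -> r^-1 ^+ 2 * expR (- (2 * c) * - ln r) <= E.
  move=> mc; rewrite ler_wpM2l ?sqr_ge0// ler_expR ler_wpM2r//.
    by rewrite oppr_ge0 ln_le0// ltW.
  by rewrite lerN2 ler_wpM2l.
apply/andP; split; last first.
  by rewrite !sqr_powRB1// [leRHS]mulrDl lerD// ler_wpM2l ?sqr_ge0// le_E// /m ge_min lexx ?orbT.
rewrite !sqr_powRB1// /E /m minEle; case: ifP => _.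
  by rewrite lerDl mulr_ge0 ?sqr_ge0// mulr_ge0 ?sqr_ge0 ?expR_ge0.
by rewrite lerDr mulr_ge0 ?sqr_ge0// mulr_ge0 ?sqr_ge0 ?expR_ge0.
Qed.

(** The squared speed is [F_mu] times the squared [g0]-norm of the velocity, and each factor has its
    own two-sided bound. *)
Lemma speed_bounds (r : R) : 0 < r < r0 ->
  Num.sqrt (c0 * cu * m ^+ 2) * q r <= speed r /\
  speed r <= Num.sqrt (C0 * `|Cu| * (w.1 ^+ 2 + w.2 ^+ 2)) * q r.
Proof.
move=> rr0; have /andP[r_gt0 r_lt1] : 0 < r < 1.
  by case/andP: rr0 => -> rr0; case/andP: r0_itv => _; exact: lt_trans.
have Ir := monomial_curve_interior _ _ _ _ _ _ w_gt0 z_V r0_eps rr0.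
have Cr := chart_interior_subset _ _ _ Ir.
set X := expR (- ln r * H_mu mu w) * Lambda mu w (- ln r).
set E := r^-1 ^+ 2 * expR (- (2 * m) * - ln r).
have X0 : 0 <= X by rewrite mulr_ge0 ?expR_ge0 ?Lambda_ge0.
have E0 : 0 <= E by rewrite mulr_ge0 ?sqr_ge0 ?expR_ge0.
have q0 : 0 <= q r by rewrite mulr_ge0 ?speed_profile_ge0// invr_ge0 ltW.
(* The choice of b makes the exponents match: e^(-2ms) e^(sH) = e^(-2bs). *)
have qE : q r = Num.sqrt (E * X).
  rewrite -[LHS]ger0_norm// -sqrtr_sqr; congr Num.sqrt.
  rewrite /q /speed_profile !exprMn sqr_sqrtr ?Lambda_ge0// /E /X -!mulrA.
  congr (_ * (_ * _)); rewrite !mulrA; congr (_ * _); rewrite -!expRD; congr expR.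
  by rewrite /b; field.
rewrite /speed derive1_monomial_curve// inner_scale.
set v := chart_point _ _ _; set p := monomial_curve w z r.
have /andP[F_lo F_hi] : cu * X <= F_mu mu u p <= `|Cu| * X.
  apply: (F_mu_monomial_bounds V_open supp_compact mu_neq0 u_gt0 u_meas cu_gt0 u_bounds) => //.
  - by rewrite r_gt0 ltW.
  - exact: coord_x_chart_point.
  - exact: coord_y_chart_point.
have /andP[v_lo v_hi] : m ^+ 2 * E <= inner euclidean_metric p v v <= (w.1 ^+ 2 + w.2 ^+ 2) * E.
  rewrite inner_euclidean_chart_point; apply: euclidean_speed_bounds.
  by rewrite r_gt0.
have g_lo := g0_lower p v Cr; have g_hi := g0_upper p v Cr.
rewrite !inner_scale in g_lo g_hi.
have C00 : 0 <= C0 by rewrite (le_trans (ltW c0_gt0)).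
have lo0 : 0 <= c0 * cu * m ^+ 2 by rewrite mulr_ge0 ?sqr_ge0// mulr_ge0// ltW.
have hi0 : 0 <= C0 * `|Cu| * (w.1 ^+ 2 + w.2 ^+ 2).
  by rewrite mulr_ge0 ?addr_ge0 ?sqr_ge0// mulr_ge0.
rewrite qE -!sqrtrM//.
split; apply: ler_wsqrtr.
- rewrite (_ : _ * _ * _ * _ = (cu * X) * (c0 * (m ^+ 2 * E))); last by ring.
  apply: ler_pM => //.
  + by rewrite mulr_ge0// ltW.
  + by rewrite mulr_ge0 ?(ltW c0_gt0)// mulr_ge0 ?sqr_ge0.
  + by apply: le_trans g_lo; rewrite ler_wpM2l// ltW.
- rewrite (_ : _ * _ * _ * (E * X) = (`|Cu| * X) * (C0 * ((w.1 ^+ 2 + w.2 ^+ 2) * E))); last by ring.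
  apply: ler_pM => //.
  + by rewrite ltW// F_gt0.
  + apply: le_trans g_lo; rewrite mulr_ge0 ?(ltW c0_gt0)//.
    by apply: le_trans v_lo; rewrite mulr_ge0 ?sqr_ge0.
  + by apply: le_trans g_hi _; rewrite ler_wpM2l.
Qed.

Lemma curve_length_lty :
  (curve_length (scale_metric (F_mu mu u) g0) (monomial_curve w z) 0 r0 < +oo)%E <->
  (\int[lebesgue_measure]_(s in `[(- ln r0)%R, +oo[)
     (speed_profile (mu := mu) w b s)%:E < +oo)%E.
Proof.
have cphi s : 0 < s -> {for s, continuous (speed_profile (mu := mu) w b)}.
  by move=> s0; exact: continuous_speed_profile.
have /andP[r0_gt0 r0_lt1] := r0_itv.
rewrite -integral_log_substitution//; last by move=> s; exact: speed_profile_ge0.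
have q0 r : 0 < r -> 0 <= q r.
  by move=> r_gt0; rewrite mulr_ge0 ?speed_profile_ge0// invr_ge0 ltW.
have mq : measurable_fun (`]0, r0[%classic : set R) (EFin \o q).
  apply/measurable_EFinP; apply: open_continuous_measurable_fun => // r.
  rewrite inE/= in_itv/= => /andP[r_gt0 rr0].
  apply: cvgM; first by apply: cvgV; [rewrite gt_eqF|exact: cvg_id].
  apply: (@continuous_comp _ _ _ (fun r => - ln r)).
    by apply: cvgN; exact: continuous_ln.
  by apply: cphi; rewrite oppr_gt0 ln_lt0// r_gt0 (lt_trans rr0).
have scale K : 0 <= K -> (\int[lebesgue_measure]_(r in `]0%R, r0[) (K * q r)%:E =
    K%:E * \int[lebesgue_measure]_(r in `]0%R, r0[) (q r)%:E)%E.
  move=> K0; under eq_integral do rewrite EFinM.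
  rewrite ge0_integralZl_EFin// => r /=; rewrite in_itv/= => /andP[r_gt0 _].
  by rewrite lee_fin q0.
have lo := scale _ (sqrtr_ge0 (c0 * cu * m ^+ 2)).
have hi := scale _ (sqrtr_ge0 (C0 * `|Cu| * (w.1 ^+ 2 + w.2 ^+ 2))).
have m0 : 0 < m by rewrite lt_min; exact/andP.
have K0 : 0 < Num.sqrt (c0 * cu * m ^+ 2).
  by rewrite sqrtr_gt0 mulr_gt0 ?exprn_gt0// mulr_gt0.
split=> [|qfin].
  (* By contraposition: a positive constant times an infinite model integral is infinite and bounds
     the length from below. *)
  apply: contraTT; rewrite -!leNgt !leye_eq => /eqP qoo.
  rewrite -leye_eq -[leLHS](gt0_muley (x := (Num.sqrt (c0 * cu * m ^+ 2))%:E)) ?lte_fin//.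
  rewrite -qoo -lo; apply: ge0_le_integral_nomeas => r /=; rewrite in_itv/= => rr0.
    by case/andP: (rr0) => r_gt0 _; rewrite lee_fin mulr_ge0 ?q0.
  by rewrite lee_fin; have [] := speed_bounds _ rr0.
apply: (@le_lt_trans _ _ (\int[lebesgue_measure]_(r in `]0%R, r0[)
  (Num.sqrt (C0 * `|Cu| * (w.1 ^+ 2 + w.2 ^+ 2)) * q r)%:E)%E).
  apply: ge0_le_integral_nomeas => r /=; rewrite in_itv/= => rr0.
    by rewrite lee_fin sqrtr_ge0.
  by rewrite lee_fin; have [] := speed_bounds _ rr0.
by rewrite hi lte_mul_pinfty// lee_fin.
Qed.

End length_comparison.

(** * The three regimes *)

Theorem theorem9p1 (R : realType) (k : nat) (V : set 'rV[R]_k) (eps : R)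
  (g0 : 'rV[R]_(2 + k) -> 'M[R]_(2 + k)) (c0 C0 : R)
  (mu : {finite_measure set (R * R)%type -> \bar R})
  (u : R * R -> 'rV[R]_(2 + k) -> R) (cu Cu : R)
  (w : R * R) (z0 : 'rV[R]_k) (r0 : R)
  (V_open : open V)
  (eps_gt0 : 0 < eps)
  (g0_metric : smooth_riemannian_metric_on (chart eps V) g0)
  (c0_gt0 : 0 < c0) (c0_le_C0 : c0 <= C0)
  (g0_lower : metric_le (chart eps V)
     (scale_metric (fun=> c0) euclidean_metric) g0)
  (g0_upper : metric_le (chart eps V)
     g0 (scale_metric (fun=> C0) euclidean_metric))
  (mu_neq0 : mu [set: (R * R)%type] != 0%E)
  (supp_compact : compact (supp mu))
  (supp_ge0 : supp mu `<=` [set a | 0 <= a.1 /\ 0 <= a.2])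
  (u_gt0 : forall a p, supp mu a -> chart_interior eps V p -> 0 < u a p)
  (u_meas : measurable_fun
     (supp mu `*` chart_interior eps V :
        set ((R * R) * g_sigma_algebraType (@open 'rV[R]_(2 + k)))%type)
     (fun ap : (R * R) * g_sigma_algebraType (@open 'rV[R]_(2 + k)) =>
        u ap.1 ap.2))
  (cu_gt0 : 0 < cu)
  (u_bounds : {ae mu, forall a, supp mu a ->
     forall p, chart_interior eps V p -> cu <= u a p <= Cu})
  (F_cont : {within chart_interior eps V, continuous (F_mu mu u)})
  (F_gt0 : forall p, chart_interior eps V p -> 0 < F_mu mu u p)
  (w_gt0 : 0 < w.1 /\ 0 < w.2)
  (z0_V : V z0)
  (r0_itv : 0 < r0 < 1)
  (r0_eps : r0 `^ w.1 < eps /\ r0 `^ w.2 < eps) :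
  let m := Num.min w.1 w.2 in
  let H := H_mu mu w in
  let L := curve_length (scale_metric (F_mu mu u) g0)
             (monomial_curve w z0) 0 r0 in
  exactly_one
    (H < 2 * m /\ (L < +oo)%E)
    (H > 2 * m /\ L = +oo%E)
    (H = 2 * m /\
     forall s0 : R, 0 <= s0 ->
       ((L < +oo)%E <->
        (\int[lebesgue_measure]_(s in `[s0, +oo[)
            (Num.sqrt (Lambda mu w s))%:E < +oo)%E)).
Proof.
move=> m H L; have /andP[r0_gt0 r0_lt1] := r0_itv.
pose b := m - H / 2; pose a := - ln r0.
have a0 : 0 <= a by rewrite oppr_ge0 ln_le0// ltW.
have LP : (L < +oo)%E <-> (\int[lebesgue_measure]_(s in `[a, +oo[)
    (speed_profile (mu := mu) w b s)%:E < +oo)%E.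
  exact: (curve_length_lty V_open c0_gt0 c0_le_C0 g0_lower g0_upper mu_neq0
    supp_compact u_gt0 u_meas cu_gt0 u_bounds F_gt0 w_gt0 z0_V r0_itv r0_eps).
(* Comparing H with 2m fixes the sign of b; in each case the other two alternatives contradict the
   comparison. *)
have [Hlt|Hgt|Heq] := ltgtP H (2 * m).
- apply: Or31; split; [split=> //| |].
  + by apply/LP; apply: integral_speed_profile_lty => //; rewrite /b; lra.
  + by case.
  + by case=> Heq _; rewrite Heq ltxx in Hlt.
- apply: Or32; split; [|split=> //|].
  + by case.
  + apply/eqP; rewrite -leye_eq leNgt; apply/negP => /LP.
    by rewrite integral_speed_profile_pinfty ?ltxx// /b; lra.
  + by case=> Heq _; rewrite Heq ltxx in Hgt.
- apply: Or33; split; [by case|by case|split=> //].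
  move=> s0 s0_ge0; rewrite LP.
  (* At equality the exponential factor is 1 and only the square root of Lambda remains. *)
  have b0 : b = 0 by rewrite /b Heq; field.
  under eq_integral do rewrite /speed_profile b0 oppr0 mul0r expR0 mul1r.
  (* The curve gives the starting point a = -ln r0, while [s0] is arbitrary; the tail lemma links
     them in either order. *)
  have [s0a|/ltW as0] := leP s0 a.
    by rewrite (integral_sqrt_Lambda_tail supp_compact mu_neq0 w _ _ s0_ge0 s0a).
  by rewrite (integral_sqrt_Lambda_tail supp_compact mu_neq0 w _ _ a0 as0).
Qed.
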